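(* Let $p$ be an odd prime. Let $\alpha,z\in\mathbb{Z}_p$ with $\langle -\alpha\rangle_p\equiv 0\pmod 2$. Then $$ {}_2F_1\bigg[\begin{matrix}\frac12\alpha&\frac32-\frac12\alpha\\ &1\end{matrix}\bigg|z\bigg]_{p-1}\;{}_2F_1\bigg[\begin{matrix}\frac12\alpha&\frac12-\frac12\alpha\\ &1\end{matrix}\bigg|z\bigg]_{p-1}\equiv{}_3F_2\bigg[\begin{matrix}\alpha&2-\alpha&\frac12\\ &1&1\end{matrix}\bigg|z\bigg]_{p-1}\pmod{p^2}. $$
   Context: $\mathbb{Z}_p$ denotes the ring of $p$-adic integers. For $x\in\mathbb{Z}_p$, $\langle x\rangle_p\in\{0,1,\ldots,p-1\}$ denotes the least nonnegative residue of $x$ modulo $p$. For $m,n\in\mathbb{N}=\{0,1,2,\ldots\}$ the truncated hypergeometric series is $$ {}_{m+1}F_m\bigg[\begin{matrix}x_0&x_1&\ldots&x_m\\ &y_1&\ldots&y_m\end{matrix}\bigg|z\bigg]_n=\sum_{k=0}^n\frac{(x_0)_k(x_1)_k\cdots(x_m)_k}{(y_1)_k\cdots(y_m)_k}\cdot\frac{z^k}{k!}, $$ where $(x)_k=x(x+1)\cdots(x+k-1)$ is the Pochhammer symbol (with $(x)_0=1$). Congruences modulo $p^2$ are in the ring $\mathbb{Z}_p$. *)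

(* Defs.v *)
From HB Require Import structures.
From mathcomp Require Import all_boot all_order all_algebra.
From mathcomp.classical Require Import boolp.

Set Implicit Arguments.
Unset Strict Implicit.
Unset Printing Implicit Defensive.

Import GRing.Theory.
Local Open Scope ring_scope.

(* The p-adic integers, as the inverse limit of the rings Z/p^(n+1). The levels
   start at exponent 1, because 'Z_1 is Z/2 in MathComp. The ring structure is
   built for every p : nat; it is that of Z_p when p is prime. *)

Definition padic_proj (p n : nat) (a : 'Z_(p ^ n.+2)) : 'Z_(p ^ n.+1) :=
  inZp a.

Record padic_int (p : nat) := PadicInt {
  padic_coord :> forall n, 'Z_(p ^ n.+1);
  padic_coherent : forall n, padic_proj (padic_coord n.+1) = padic_coord n
}.

Section PadicRing.
Variable p : nat.

Lemma Zp_trunc_dvd n : ((Zp_trunc (p ^ n.+1)).+2 %| (Zp_trunc (p ^ n.+2)).+2)%N.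
Proof.
case: p => [|[|q]]; rewrite ?exp1n ?exp0n //.
have gt1 m : (1 < q.+2 ^ m.+1)%N by rewrite -(exp1n m.+1) ltn_exp2r.
by rewrite !Zp_cast // dvdn_exp2l.
Qed.

Lemma padic_proj_add n : {morph @padic_proj p n : a b / a + b}.
Proof.
move=> a b; apply: val_inj => /=.
by rewrite modn_dvdm ?Zp_trunc_dvd // modnDm.
Qed.

Lemma padic_proj_mul n : {morph @padic_proj p n : a b / a * b}.
Proof.
move=> a b; apply: val_inj => /=.
by rewrite modn_dvdm ?Zp_trunc_dvd // modnMm.
Qed.

Lemma padic_proj0 n : @padic_proj p n 0 = 0.
Proof. by apply: val_inj; rewrite /= mod0n. Qed.

Lemma padic_proj1 n : @padic_proj p n 1 = 1.
Proof. by apply: val_inj. Qed.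

Lemma padic_proj_opp n : {morph @padic_proj p n : a / - a}.
Proof.
move=> a; apply: (addrI (padic_proj a)).
by rewrite -padic_proj_add !subrr padic_proj0.
Qed.

Lemma padic_ext (x y : padic_int p) : (forall n, x n = y n) -> x = y.
Proof.
case: x y => [x cx] [y cy] /= exy.
have e : x = y by apply: functional_extensionality_dep.
by case: _ / e cy => cy; congr PadicInt; apply: Prop_irrelevance.
Qed.

Lemma padic_zero_subproof n : padic_proj (0 : 'Z_(p ^ n.+2)) = 0.
Proof. exact: padic_proj0. Qed.
Definition padic_zero := PadicInt padic_zero_subproof.

Lemma padic_one_subproof n : padic_proj (1 : 'Z_(p ^ n.+2)) = 1.
Proof. exact: padic_proj1. Qed.
Definition padic_one := PadicInt padic_one_subproof.

Lemma padic_opp_subproof (x : padic_int p) n : padic_proj (- x n.+1) = - x n.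
Proof. by rewrite padic_proj_opp padic_coherent. Qed.
Definition padic_opp x := PadicInt (padic_opp_subproof x).

Lemma padic_add_subproof (x y : padic_int p) n :
  padic_proj (x n.+1 + y n.+1) = x n + y n.
Proof. by rewrite padic_proj_add !padic_coherent. Qed.
Definition padic_add x y := PadicInt (padic_add_subproof x y).

Lemma padic_mul_subproof (x y : padic_int p) n :
  padic_proj (x n.+1 * y n.+1) = x n * y n.
Proof. by rewrite padic_proj_mul !padic_coherent. Qed.
Definition padic_mul x y := PadicInt (padic_mul_subproof x y).

HB.instance Definition _ := gen_eqMixin (padic_int p).
HB.instance Definition _ := gen_choiceMixin (padic_int p).

Lemma padic_addA : associative padic_add.
Proof. by move=> x y z; apply: padic_ext => n; apply: addrA. Qed.
Lemma padic_addC : commutative padic_add.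
Proof. by move=> x y; apply: padic_ext => n; apply: addrC. Qed.
Lemma padic_add0 : left_id padic_zero padic_add.
Proof. by move=> x; apply: padic_ext => n; apply: add0r. Qed.
Lemma padic_addN : left_inverse padic_zero padic_opp padic_add.
Proof. by move=> x; apply: padic_ext => n; apply: addNr. Qed.

HB.instance Definition _ := GRing.isZmodule.Build (padic_int p)
  padic_addA padic_addC padic_add0 padic_addN.

Lemma padic_mulA : associative padic_mul.
Proof. by move=> x y z; apply: padic_ext => n; apply: mulrA. Qed.
Lemma padic_mulC : commutative padic_mul.
Proof. by move=> x y; apply: padic_ext => n; apply: mulrC. Qed.
Lemma padic_mul1 : left_id padic_one padic_mul.
Proof. by move=> x; apply: padic_ext => n; apply: mul1r. Qed.
Lemma padic_mulDl : left_distributive padic_mul padic_add.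
Proof. by move=> x y z; apply: padic_ext => n; apply: mulrDl. Qed.
Lemma padic_one_neq0 : padic_one != padic_zero.
Proof. by apply/eqP => /(congr1 (fun x : padic_int p => x 0%N : nat)). Qed.

HB.instance Definition _ := GRing.Zmodule_isComNzRing.Build (padic_int p)
  padic_mulA padic_mulC padic_mul1 padic_mulDl padic_one_neq0.

Definition padic_unit : pred (padic_int p) :=
  fun x => `[< forall n, x n \is a GRing.unit >].

Lemma padic_inv_subproof (x : padic_int p) n :
  padic_proj (if padic_unit x then (x n.+1)^-1 else x n.+1)
    = if padic_unit x then (x n)^-1 else x n.
Proof.
case: ifPn => [/asboolP ux|_]; last exact: padic_coherent.
apply: (mulrI (ux n)); rewrite -[in LHS]padic_coherent -padic_proj_mul.
by rewrite !divrr ?ux // padic_proj1.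
Qed.
Definition padic_inv x := PadicInt (padic_inv_subproof x).

Lemma padic_mulV : {in padic_unit, left_inverse 1 padic_inv *%R}.
Proof.
move=> x ux; have {}ux : padic_unit x by [].
apply: padic_ext => n; rewrite -[LHS]/(padic_inv x n * x n) /= ux mulVr //.
exact: (asboolW ux).
Qed.

Lemma padic_unitP (x y : padic_int p) : y * x = 1 -> padic_unit x.
Proof.
move=> yx1; apply/asboolP => n; apply/unitrPr; exists (y n).
by rewrite mulrC -[y n * x n]/((y * x) n) yx1.
Qed.

Lemma padic_inv_out : {in [predC padic_unit], padic_inv =1 id}.
Proof.
move=> x nux; have {}nux : padic_unit x = false by apply: negbTE.
by apply: padic_ext => n /=; rewrite nux.
Qed.

HB.instance Definition _ := GRing.ComNzRing_hasMulInverse.Build (padic_int p)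
  padic_mulV padic_unitP padic_inv_out.

End PadicRing.

(* Congruence modulo d in a commutative ring: d divides x - y. *)
Definition eqmod (R : comNzRingType) (d x y : R) : Prop :=
  exists c : R, x - y = d * c.

(* The representative in {0, ..., p - 1} of the image of x in Z/p;
   see padic_residue_ltn and padic_residueP. *)
Definition padic_residue (p : nat) (x : padic_int p) : nat := x 0%N.

Section PadicTheory.
Variable p : nat.
Hypothesis p_gt1 : (1 < p)%N.

Let modulusE n : (Zp_trunc (p ^ n.+1)).+2 = (p ^ n.+1)%N.
Proof. by rewrite Zp_cast // -(exp1n n.+1) ltn_exp2r. Qed.

Let val_mod n k : val (inZp k : 'Z_(p ^ n.+1)) = (k %% p ^ n.+1)%N.
Proof. by rewrite /= modulusE. Qed.

Let coord_lt (x : padic_int p) n : (x n < p ^ n.+1)%N.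
Proof. by rewrite -[X in (_ < X)%N]modulusE ltn_ord. Qed.

Lemma padic_natE k n : (k%:R : padic_int p) n = k%:R.
Proof. by elim: k => // k IHk; rewrite -!natr1 -IHk. Qed.

Lemma padic_coord_mod (x : padic_int p) n k :
  (x (n + k)%N %% p ^ n.+1 = x n)%N.
Proof.
elim: k => [|k IHk]; first by rewrite addn0 modn_small.
rewrite -IHk addnS -(padic_coherent x (n + k)) /padic_proj val_mod.
by rewrite modn_dvdm // dvdn_exp2l // ltnS leq_addr.
Qed.

Lemma padic_eqmodP (x y : padic_int p) n :
  eqmod (p ^ n.+1)%:R x y <-> x n = y n.
Proof.
split=> [[c Exy]|Exy].
  apply/eqP; rewrite -subr_eq0 -[x n - y n]/((x - y) n) Exy; apply/eqP.
  rewrite -[LHS]/(((p ^ n.+1)%:R : padic_int p) n * c n) padic_natE.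
  suff -> : (p ^ n.+1)%:R = 0 :> 'Z_(p ^ n.+1) by rewrite mul0r.
  by apply: val_inj; rewrite Zp_nat val_mod modnn.
pose z := x - y.
have z0 : z n = 0 by apply/eqP; rewrite subr_eq0 Exy.
have dvz k : (p ^ n.+1 %| z (n + k)%N)%N.
  by rewrite /dvdn padic_coord_mod z0.
pose c k : 'Z_(p ^ k.+1) := inZp (z (n + k.+1)%N %/ p ^ n.+1).
have val_mul m (a b : 'Z_(p ^ m.+1)) : val (a * b) = (a * b %% p ^ m.+1)%N.
  by rewrite -[X in (_ %% X)%N]modulusE.
have cc k : padic_proj (c k.+1) = c k.
  apply: val_inj; rewrite /padic_proj !val_mod modn_dvdm ?dvdn_exp2l //.
  rewrite -(padic_coord_mod z (n + k.+1) 1) addn1.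
  have -> : (p ^ (n + k.+1).+1 = p ^ k.+1 * p ^ n.+1)%N.
    by rewrite -expnD addSn -addnS addnC addnS addSn.
  by rewrite -modn_divl modn_mod (addnS n k.+1).
exists (PadicInt cc); apply: padic_ext => k.
rewrite -[LHS]/(z k) -[RHS]/(((p ^ n.+1)%:R : padic_int p) k * c k) padic_natE.
apply: val_inj; rewrite val_mul Zp_nat.
rewrite -![nat_of_ord (inZp _)]/(val _) !val_mod modnMm mulnC divnK ?dvz //.
by rewrite addnC addSnnS padic_coord_mod.
Qed.

Lemma padic_residue_ltn (x : padic_int p) : (padic_residue x < p)%N.
Proof. exact: coord_lt. Qed.

Lemma padic_residueP (x : padic_int p) :
  eqmod p%:R x (padic_residue x)%:R.
Proof.
apply/(padic_eqmodP _ _ 0); rewrite padic_natE; apply: val_inj.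
by rewrite Zp_nat val_mod modn_small // coord_lt.
Qed.

End PadicTheory.

Definition pochhammer (R : comUnitRingType) (x : R) (k : nat) : R :=
  \prod_(i < k) (x + i%:R).

(* The quotient is taken in R: in padic_int p it has its usual meaning as long as
   the denominators are units, as for lower parameters all equal to 1 and n < p
   (the denominators are then powers of k! with k < p). *)
Definition trunc_hypergeom (R : comUnitRingType) (m : nat)
    (xs : m.+1.-tuple R) (ys : m.-tuple R) (z : R) (n : nat) : R :=
  \sum_(k < n.+1)
    (\prod_(x <- xs) pochhammer x k) / (\prod_(y <- ys) pochhammer y k)
      * (z ^+ k / (k`!)%:R).

(* Main.v *)
Require Import Defs.
From mathcomp Require Import all_boot all_order all_algebra.
From mathcomp Require Import ring zify.
From mathcomp.classical Require boolp.

Set Implicit Arguments.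
Unset Strict Implicit.
Unset Printing Implicit Defensive.

Import GRing.Theory.
Local Open Scope ring_scope.

(** Write x for alpha, and c_i, d_j for the coefficients of the two 2F1 series.

As formal power series the two sides agree exactly (an identity of Orr type),
and over the p-adic integers this gives sum_(i+j=n) c_i d_j = t_n for n < p,
t_n being the coefficients of the 3F2 series: lemma [hyper_coef_conv].  So the
product of the truncated series differs from the truncated 3F2 only by the terms
c_i d_j z^(i+j) with i, j < p <= i + j, and each of these is divisible by p^2
([hyper_coef_tail]).  Indeed let a = 2m be the residue of -x and
p = 2(m + m') + 1.  Then p divides x/2 + m and 1/2 - x/2 + m'.  Since i + j is
large, one of i, j exceeds m, which gives a factor p in (x/2)_i (x/2)_j, and one
of the other two Pochhammer symbols reaches the factor 1/2 - x/2 + m', which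
also occurs in (3/2 - x/2)_i because 3/2 - x/2 + (m' - 1) is the same number.

The exact identity rests on Clausen's formula
2F1(x/2, (1-x)/2; 1)^2 = 3F2(x, 1-x, 1/2; 1, 1).  The coefficients of this
square satisfy a first-order recurrence, proved by creative telescoping
([clausen_sumS]).  Put b = (1-x)/2.  From b (b+1)_i = (b)_i (b + i), each term
of the Orr sum is (b + i)/b times the corresponding term of the Clausen sum, and
by the symmetry between i and n - i the factor b + i averages to b + n/2
([orr_clausen]).  This determines the Orr sum once b can be cancelled.  With
denominators cleared by powers of 2 and factorials, the identity is between polynomials
in x with integer coefficients, so it suffices to cancel b in Z[X] and then to
specialize X ([orr_sumE]). *)

(** * Pochhammer symbols *)

(** Equal to 2^n (x/2)_n, but meaningful in rings where 2 is not invertible,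
    such as Z[X]. *)
Definition pochhammer2 (R : comUnitRingType) (x : R) (n : nat) : R :=
  \prod_(i < n) (x + (2 * i)%:R).

Lemma pochhammer2S (R : comUnitRingType) (x : R) n :
  pochhammer2 x n.+1 = pochhammer2 x n * (x + (2 * n)%:R).
Proof. by rewrite /pochhammer2 big_ord_recr. Qed.

Lemma pochhammerS (R : comUnitRingType) (x : R) n :
  pochhammer x n.+1 = pochhammer x n * (x + n%:R).
Proof. by rewrite /pochhammer big_ord_recr. Qed.

Lemma pochhammer2_shift (R : comUnitRingType) (x : R) n :
  x * pochhammer2 (x + 2) n = pochhammer2 x n * (x + (2 * n)%:R).
Proof.
rewrite -pochhammer2S /pochhammer2 big_ord_recl /= muln0 addr0; congr (_ * _).
by apply: eq_bigr => i _; rewrite /bump /= -addrA -natrD; congr (_ + _%:R); lia.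
Qed.

Lemma pochhammer_shift (R : comUnitRingType) (x : R) n :
  x * pochhammer (x + 1) n = pochhammer x n * (x + n%:R).
Proof.
rewrite -pochhammerS /pochhammer big_ord_recl /= addr0; congr (_ * _).
by apply: eq_bigr => i _; rewrite /bump /= natrD addrA.
Qed.

Lemma pochhammer2_half (R : comUnitRingType) (x : R) n :
  2 \is a @GRing.unit R ->
  pochhammer2 x n = 2 ^+ n * pochhammer (1 / 2 * x) n.
Proof.
move=> u2; rewrite /pochhammer -[n in 2 ^+ n]card_ord -prodr_const -big_split /=.
apply: eq_bigr => i _; rewrite mulrDr mulrA mulrCA divrr // mulr1 mul1r.
by rewrite natrM.
Qed.

Lemma half_mulB (R : comUnitRingType) (x : R) (c : nat) :
  1 / 2 * (c%:R - x) = c%:R / 2 - 1 / 2 * x.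
Proof. by rewrite mulrBr; congr (_ - _); rewrite mulrAC mul1r. Qed.

Lemma pochhammer1 (R : comUnitRingType) n : pochhammer (1 : R) n = n`!%:R.
Proof.
elim: n => [|n IHn]; first by rewrite /pochhammer big_ord0.
by rewrite pochhammerS IHn factS mulnC natrM nat1r.
Qed.

Lemma rmorph_pochhammer (R S : comUnitRingType) (f : {rmorphism R -> S}) x n :
  f (pochhammer x n) = pochhammer (f x) n.
Proof.
by rewrite rmorph_prod; apply: eq_bigr => i _; rewrite rmorphD rmorph_nat.
Qed.

Lemma rmorph_pochhammer2 (R S : comUnitRingType) (f : {rmorphism R -> S}) x n :
  f (pochhammer2 x n) = pochhammer2 (f x) n.
Proof.
by rewrite rmorph_prod; apply: eq_bigr => i _; rewrite rmorphD rmorph_nat.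
Qed.

(** * Clausen's formula with denominators cleared *)

Section Clausen.
Variables (R : comUnitRingType) (x : R).

Let u n : R := pochhammer2 x n * pochhammer2 (1 - x) n.

Let uS n : u n.+1 = u n * ((x + (2 * n)%:R) * (1 - x + (2 * n)%:R)).
Proof. by rewrite /u !pochhammer2S mulrACA. Qed.

(** This is 4^n n!^2 times the coefficient of z^n in 2F1(x/2, (1-x)/2; 1; z)^2. *)
Definition clausen_sum n : R :=
  \sum_(i < n.+1) 'C(n, i)%:R ^+ 2 * (u i * u (n - i)).

(** The telescoping certificate for the recurrence [clausen_sumS].  It is found by
    looking for G(n, i) = i^2 q(i) f_i f_(N-i), with N = n+1 and f_i the
    coefficients of the 2F1 series.  Equating the G-difference with the defect of
    the recurrence makes (N - i)^2 divide N^3 + i^2 q(i), which forces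
    q(i) = 2i - 3N in degree one, with quotient N + 2i. *)
Let cert n i : R :=
  if i is i'.+1 then
    ((2 * i)%:R - (3 * n.+1)%:R) * 'C(n, i')%:R ^+ 2 * (u i * u (n - i'))
  else 0.

Let certP n i : (i <= n)%N ->
  n.+1%:R * ('C(n.+1, i)%:R ^+ 2 * (u i * u (n.+1 - i))) =
  2 * (x + n%:R) * (1 - x + n%:R) * (2 * n).+1%:R
    * ('C(n, i)%:R ^+ 2 * (u i * u (n - i))) + (cert n i.+1 - cert n i).
Proof.
move=> le_in; have [j ->] : exists j, n = (i + j)%N by exists (n - i)%N; lia.
have -> : ((i + j).+1 - i = j.+1)%N by lia.
have -> : (i + j - i = j)%N by lia.
case: i {le_in} => [|i].
  rewrite /cert !add0n subn0 !bin0 !uS; ring.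
rewrite /cert; have -> : (i.+1 + j - i = j.+1)%N by lia.
have -> : (i.+1 + j - i.+1 = j)%N by lia.
rewrite binS natrD.
have /(congr1 (fun k => k%:R : R)) := mul_bin_left (i.+1 + j) i.
have -> : (i.+1 + j - i = j.+1)%N by lia.
rewrite !natrM.
set a : R := 'C(_, i.+1)%:R; set b : R := 'C(_, i)%:R => Eab.
rewrite (uS j) (uS i.+1).
set U := u i.+1; set V := u j.
apply/eqP; rewrite -subr_eq0.
set w := (x + (2 * j)%:R) * (1 - x + (2 * j)%:R).
(* The two sides differ by a multiple of i C(n,i) - (n+1-i) C(n,i-1) = 0; this
   relation is what turns N (a+b)^2 + (2i - 3N) b^2 into (N + 2i) a^2. *)
apply/eqP; transitivity (2 * (b - a) * (i.+1%:R * a - j.+1%:R * b)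
  * U * V * w); last first.
  by rewrite Eab subrr mulr0 !mul0r.
rewrite /w; ring.
Qed.

Lemma clausen_sumS n :
  n.+1%:R * clausen_sum n.+1 =
  2 * (x + n%:R) * (1 - x + n%:R) * (2 * n).+1%:R * clausen_sum n.
Proof.
rewrite /clausen_sum mulr_sumr big_ord_recr /=.
under eq_bigr => i _ do rewrite certP -1?ltnS //.
rewrite big_split /= -mulr_sumr -[RHS]addr0 -addrA; congr (_ + _).
rewrite -(big_mkord xpredT (fun i => cert n i.+1 - cert n i)) telescope_sumr //.
(* The term i = n+1 of the left-hand sum cancels the end value of the certificate. *)
rewrite /cert !binn !subnn; ring.
Qed.

Lemma clausen_sumE n :
  n`!%:R * clausen_sum n =
  2 ^+ n * (pochhammer x n * pochhammer (1 - x) n) * pochhammer2 1 n.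
Proof.
elim: n => [|n IHn].
  rewrite /clausen_sum big_ord1 /u /pochhammer /pochhammer2 !big_ord0 bin0 fact0.
  by rewrite expr1n !mulr1.
rewrite factS mulnC natrM -mulrA clausen_sumS mulrCA IHn !pochhammerS.
by rewrite pochhammer2S exprS; ring.
Qed.

(** * Orr's product formula with denominators cleared *)

(** This is 4^n n!^2 times the coefficient of z^n in
    2F1(x/2, (3-x)/2; 1; z) 2F1(x/2, (1-x)/2; 1; z). *)
Definition orr_sum n : R :=
  \sum_(i < n.+1) 'C(n, i)%:R ^+ 2 *
    ((pochhammer2 x i * pochhammer2 (3 - x) i)
     * (pochhammer2 x (n - i) * pochhammer2 (1 - x) (n - i))).

(** Multiplication by 1 - x turns the parameter 3 - x back into 1 - x and weights
    the i-th term of the Clausen sum by 1 - x + 2i.  The sum doubled is this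
    expression plus the same one with i replaced by n - i, and the two weights add
    up to 2(1 - x + n), which does not depend on i. *)
Lemma orr_clausen n :
  2 * ((1 - x) * orr_sum n) = 2 * ((1 - x + n%:R) * clausen_sum n).
Proof.
have E : (1 - x) * orr_sum n =
    \sum_(i < n.+1) (1 - x + (2 * i)%:R) * ('C(n, i)%:R ^+ 2 * (u i * u (n - i))).
  rewrite /orr_sum mulr_sumr; apply: eq_bigr => i _.
  have -> : 3 - x = 1 - x + 2 by ring.
  have := pochhammer2_shift (1 - x) i.
  set P := pochhammer2 (1 - x + 2) i => EP.
  set A := pochhammer2 x i; set W := _ * pochhammer2 (1 - x) (n - i).
  transitivity ('C(n, i)%:R ^+ 2 * (A * ((1 - x) * P) * W)); first ring.
  by rewrite EP /u -/A -/W; ring.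
have E' : (1 - x) * orr_sum n =
    \sum_(i < n.+1) (1 - x + (2 * (n - i))%:R) *
      ('C(n, i)%:R ^+ 2 * (u i * u (n - i))).
  rewrite E (reindex_inj rev_ord_inj) /=; apply: eq_bigr => i _.
  have le_in : (i <= n)%N by rewrite -ltnS.
  by rewrite subSS subKn // bin_sub // [u (n - i) * _]mulrC.
rewrite mulr_natl mulr2n {1}E E' -big_split /= /clausen_sum !mulr_sumr.
apply: eq_bigr => i _; have le_in : (i <= n)%N by rewrite -ltnS.
rewrite -mulrDl [RHS]mulrA; congr (_ * _); rewrite !natrM natrB //; ring.
Qed.
End Clausen.

Lemma rmorph_orr_sum (R S : comUnitRingType) (f : {rmorphism R -> S}) x n :
  f (orr_sum x n) = orr_sum (f x) n.
Proof.
rewrite rmorph_sum; apply: eq_bigr => i _.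
rewrite rmorphM rmorphXn /= 3!rmorphM !rmorph_pochhammer2 !rmorphB !rmorph_nat.
by rewrite rmorph1.
Qed.

(** In Z[X] the factor 2(1 - X) of [orr_clausen] can be cancelled, whereas in R the
    element 1 - x may be zero or a zero divisor. *)
Lemma orr_sumE (R : comUnitRingType) (x : R) n :
  n`!%:R * orr_sum x n =
  2 ^+ n * (pochhammer x n * pochhammer (2 - x) n) * pochhammer2 1 n.
Proof.
suff EX : n`!%:R * orr_sum ('X : {poly int}) n =
    2 ^+ n * (pochhammer 'X n * pochhammer (2 - 'X) n) * pochhammer2 1 n.
  have xC : commr_rmorph (intr : int -> R) x by move=> a; apply: mulrC.
  pose f : {rmorphism {poly int} -> R} := horner_morph xC.
  have fX : f 'X = x by rewrite /f /= horner_morphX.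
  move/(congr1 f): EX; rewrite !rmorphM rmorph_orr_sum !rmorph_pochhammer.
  by rewrite rmorph_pochhammer2 rmorphXn rmorphB !rmorph_nat rmorph1 fX.
have nz : (2 * (1 - 'X) : {poly int}) != 0.
  rewrite mulf_neq0 ?polyC_eq0 //; first by rewrite -polyC_natr polyC_eq0.
  by rewrite -opprB oppr_eq0 polyXsubC_eq0.
apply: (mulfI nz).
transitivity (n`!%:R * (2 * ((1 - 'X) * orr_sum ('X : {poly int}) n))); first ring.
rewrite orr_clausen.
transitivity (2 * (1 - 'X + n%:R) * (n`!%:R * clausen_sum ('X : {poly int}) n)).
  ring.
rewrite clausen_sumE.
have -> : (2 - 'X : {poly int}) = 1 - 'X + 1 by ring.
have := pochhammer_shift (1 - 'X : {poly int}) n.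
set P := pochhammer (1 - 'X + 1) n => EP.
transitivity (2 * (2 ^+ n * (pochhammer 'X n * ((1 - 'X) * P)) * pochhammer2 1 n
  : {poly int})); last ring.
rewrite EP; ring.
Qed.

(** * Coefficients of the hypergeometric series *)

Definition hyper_coef (R : comUnitRingType) (x y : R) (n : nat) : R :=
  pochhammer x n * pochhammer y n / n`!%:R ^+ 2.

Lemma trunc_hypergeom2E (R : comUnitRingType) (x y z : R) n :
  trunc_hypergeom [tuple x; y] [tuple 1] z n =
  \sum_(k < n.+1) hyper_coef x y k * z ^+ k.
Proof.
apply: eq_bigr => k _; rewrite !big_cons !big_nil !mulr1 pochhammer1.
by rewrite /hyper_coef -exprVn; ring.
Qed.

Lemma trunc_hypergeom3E (R : comUnitRingType) (x y w z : R) n :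
  trunc_hypergeom [tuple x; y; w] [tuple 1; 1] z n =
  \sum_(k < n.+1)
    (pochhammer x k * pochhammer y k * pochhammer w k / k`!%:R ^+ 3) * z ^+ k.
Proof.
apply: eq_bigr => k _; rewrite !big_cons !big_nil !mulr1 pochhammer1.
by rewrite -expr2 -!exprVn; ring.
Qed.

Section Convolution.
Variables (R : comUnitRingType) (p : nat).
Hypothesis unit2 : 2 \is a @GRing.unit R.
Hypothesis unit_lt : forall k, (0 < k < p)%N -> k%:R \is a @GRing.unit R.

Let fact_unit n : (n < p)%N -> n`!%:R \is a @GRing.unit R.
Proof.
elim: n => [|n IHn] lt_np; first by rewrite fact0 unitr1.
by rewrite factS natrM unitrM unit_lt // IHn // ltnW.
Qed.

(** Multiplying by the unit 4^n n!^3 gives [orr_sumE].  The bound on n makes all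
    denominators invertible. *)
Lemma hyper_coef_conv (x : R) n : (n < p)%N ->
  \sum_(i < n.+1) hyper_coef (1 / 2 * x) (3 / 2 - 1 / 2 * x) i
                  * hyper_coef (1 / 2 * x) (1 / 2 - 1 / 2 * x) (n - i) =
  pochhammer x n * pochhammer (2 - x) n * pochhammer (1 / 2) n / n`!%:R ^+ 3.
Proof.
move=> lt_np; have ufn := fact_unit lt_np.
have half3 : 3 / 2 - 1 / 2 * x = 1 / 2 * (3 - x) by rewrite half_mulB.
have half1 : 1 / 2 - 1 / 2 * x = 1 / 2 * (1 - x) by rewrite (half_mulB x 1).
have uK : 4 ^+ n * n`!%:R ^+ 3 \is a @GRing.unit R.
  have u4 : 4 \is a @GRing.unit R by rewrite -[4]/((2 * 2)%:R) natrM unitrM unit2.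
  by rewrite unitrM !unitrX.
apply: (mulrI uK); transitivity (n`!%:R * orr_sum x n); last first.
  rewrite orr_sumE pochhammer2_half // mulr1.
  set f := n`!%:R; set P := pochhammer x n; set Q := pochhammer (2 - x) n.
  transitivity (4 ^+ n * (P * Q * pochhammer (1 / 2) n) * (f ^+ 3 / f ^+ 3)); last ring.
  by rewrite divrr ?unitrX // -[4]/((2 * 2)%:R) natrM exprMn; ring.
rewrite /orr_sum !mulr_sumr; apply: eq_bigr => i _.
have le_in : (i <= n)%N by rewrite -ltnS.
have ui := fact_unit (leq_ltn_trans le_in lt_np).
have uni := fact_unit (leq_ltn_trans (leq_subr i n) lt_np).
rewrite /hyper_coef half3 half1 !(pochhammer2_half _ _ unit2).
set a := pochhammer _ i; set b := pochhammer _ i; set c := pochhammer _ (n - i).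
set d := pochhammer _ (n - i).
have -> : n`!%:R ^+ 3 = n`!%:R * ('C(n, i)%:R * (i`!%:R * (n - i)`!%:R)) ^+ 2 :> R.
  by rewrite -!natrM bin_fact // -exprS.
have -> : 4 ^+ n = (2 ^+ i * 2 ^+ (n - i)) ^+ 2 :> R.
  by rewrite -exprD subnKC // -exprM mulnC exprM expr2 -natrM.
move: ui uni; set f := i`!%:R; set g := (n - i)`!%:R => ui uni.
set P := 2 ^+ i; set Q := 2 ^+ (n - i).
transitivity (n`!%:R * ('C(n, i)%:R ^+ 2 * ((P * a * (P * b)) * (Q * c * (Q * d))))
  * (f ^+ 2 / f ^+ 2) * (g ^+ 2 / g ^+ 2)); first ring.
by rewrite !divrr ?unitrX // !mulr1.
Qed.

End Convolution.

(** * Divisibility and rearrangement of sums *)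

Definition divides (R : comNzRingType) (d x : R) := exists c, x = d * c.

Lemma divides_mull (R : comNzRingType) (d x y : R) :
  divides d x -> divides d (x * y).
Proof. by case=> c ->; exists (c * y); rewrite mulrA. Qed.

Lemma divides_mulr (R : comNzRingType) (d x y : R) :
  divides d y -> divides d (x * y).
Proof. by rewrite mulrC; apply: divides_mull. Qed.

Lemma divides_mul (R : comNzRingType) (d e x y : R) :
  divides d x -> divides e y -> divides (d * e) (x * y).
Proof. by case=> a -> [b ->]; exists (a * b); rewrite mulrACA. Qed.

Lemma divides_sum (R : comNzRingType) (d : R) (I : Type) (r : seq I)
    (P : pred I) (F : I -> R) :
  (forall i, P i -> divides d (F i)) -> divides d (\sum_(i <- r | P i) F i).
Proof.
move=> dF; elim/big_ind: _ => //; first by exists 0; rewrite mulr0.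
by move=> _ _ [a ->] [b ->]; exists (a + b); rewrite mulrDr.
Qed.

Lemma divides_pochhammer (R : comUnitRingType) (d x : R) m n :
  (m < n)%N -> divides d (x + m%:R) -> divides d (pochhammer x n).
Proof.
move=> lt_mn dx; rewrite /pochhammer (bigD1 (Ordinal lt_mn)) //=.
exact: divides_mull.
Qed.

(** Used to separate a product of two truncated series into their Cauchy product up
    to degree N - 1 and the terms that the truncation leaves over. *)
Lemma sum_square_split (V : zmodType) (F : nat -> nat -> V) N :
  \sum_(i < N) \sum_(j < N) F i j =
  \sum_(n < N) \sum_(i < n.+1) F i (n - i)%N
  + \sum_(i < N) \sum_(N - i <= j < N) F i j.
Proof.
have -> : \sum_(n < N) \sum_(i < n.+1) F i (n - i)%N =
    \sum_(n < N) \sum_(i < N | (i <= n)%N) F i (n - i)%N.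
  apply: eq_bigr => n _.
  rewrite (big_ord_widen N (fun i => F i (n - i)%N)) ?ltn_ord //.
rewrite [X in _ = X + _](exchange_big_dep xpredT) //= -big_split /=.
apply: eq_bigr => i _; rewrite -(big_mkord xpredT (F i)) (@big_cat_nat _ _ _ (N - i)) ?leq_subr //=.
congr (_ + _); rewrite -(big_mkord (fun n => i <= n)%N (fun n => F i (n - i)%N)).
rewrite [RHS](@big_cat_nat _ _ _ i) ?(ltnW (ltn_ord i)) //=.
have -> : \sum_(0 <= n < i | (i <= n)%N) F i (n - i)%N = 0.
  by rewrite big_nat_cond big_pred0 // => n; rewrite /= ltnNge andNb.
rewrite add0r.
rewrite -{3}[nat_of_ord i]add0n big_addn big_nat_cond [RHS]big_nat_cond.
apply: eq_big => [n|n _]; first by rewrite leq_addl andbT.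
by rewrite addnK.
Qed.

(** * The congruence modulo p^2 *)

(** The model is a ring where p is a non-unit prime and the other primes are units.
    The hypothesis on x says that -x has the even residue 2m, and then 2m' is
    p - 1 - 2m. *)
Section SuperCongruence.
Variables (R : comUnitRingType) (p : nat).
Hypothesis unit2 : 2 \is a @GRing.unit R.
Hypothesis unit_lt : forall k, (0 < k < p)%N -> k%:R \is a @GRing.unit R.
Variables (x z : R) (m m' : nat).
Hypothesis p_mm' : p = (m + m').*2.+1.
Hypothesis x_mod : divides p%:R (x + m.*2%:R).

Let halfD y k : 1 / 2 * (y + k.*2%:R) = 1 / 2 * y + k%:R :> R.
Proof. by rewrite mulrDr -mul2n natrM mul1r mulrA mulVr // mul1r. Qed.

(** One factor p comes from (x/2)_i (x/2)_j, the other from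
    (3/2 - x/2)_i (1/2 - x/2)_j. *)
Lemma hyper_coef_tail i j : (i < p)%N -> (j < p)%N -> (p <= i + j)%N ->
  divides (p%:R ^+ 2) (hyper_coef (1 / 2 * x) (3 / 2 - 1 / 2 * x) i
                       * hyper_coef (1 / 2 * x) (1 / 2 - 1 / 2 * x) j).
Proof.
move=> lt_ip lt_jp le_p_ij; rewrite /hyper_coef.
set A := 1 / 2 * x; set B := 3 / 2 - _; set C := 1 / 2 - _.
rewrite mulrACA; apply: divides_mull; rewrite mulrACA expr2.
have dA : divides p%:R (A + m%:R) by rewrite /A -halfD; apply: divides_mulr.
have dC : divides p%:R (C + m'%:R).
  have -> : C + m'%:R = 1 / 2 * (p%:R - (x + m.*2%:R)).
    rewrite /C /A -(half_mulB x 1) -halfD; congr (_ * _).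
    by rewrite p_mm' -!mul2n; ring.
  apply: divides_mulr; case: x_mod => c ->; exists (1 - c).
  by rewrite mulrBr mulr1.
apply: divides_mul.
  (* If i, j <= m then i + j <= 2m < p. *)
  have [lt_mi|le_im] := ltnP m i.
    exact/divides_mull/(divides_pochhammer lt_mi).
  by apply/divides_mulr/(@divides_pochhammer _ _ _ m) => //; lia.
(* If i < m' and j <= m' then i + j <= 2m' < p; when m' = 0, the bound i < p
   already forces j > m'. *)
have [lt_mj|le_jm] := ltnP m' j.
  exact/divides_mulr/(divides_pochhammer lt_mj).
have m'_gt0 : (0 < m')%N by lia.
apply/divides_mull/(@divides_pochhammer _ _ _ m'.-1); first by lia.
suff -> : B + m'.-1%:R = C + m'%:R by [].
rewrite -[in RHS](prednK m'_gt0) -nat1r addrA; congr (_ + _).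
by rewrite /B /C addrAC -[3]/((1 + 2)%:R) natrD mulrDl divrr.
Qed.

Lemma orr_supercongruence :
  eqmod ((p ^ 2)%:R : R)
    (trunc_hypergeom [tuple 1 / 2 * x; 3 / 2 - 1 / 2 * x] [tuple 1] z p.-1
     * trunc_hypergeom [tuple 1 / 2 * x; 1 / 2 - 1 / 2 * x] [tuple 1] z p.-1)
    (trunc_hypergeom [tuple x; 2 - x; 1 / 2] [tuple 1; 1] z p.-1).
Proof.
have p_gt0 : (0 < p)%N by rewrite p_mm'.
rewrite !trunc_hypergeom2E trunc_hypergeom3E prednK //.
set c := hyper_coef _ _; set d := hyper_coef _ _.
pose F i j := c i * z ^+ i * (d j * z ^+ j).
have -> : (\sum_(k < p) c k * z ^+ k) * (\sum_(k < p) d k * z ^+ k) =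
    \sum_(i < p) \sum_(j < p) F i j.
  by rewrite mulr_suml; apply: eq_bigr => i _; rewrite mulr_sumr.
rewrite sum_square_split.
set S := \sum_(n < p) _; set T := \sum_(n < p) _ * _.
have -> : S = T.
  apply: eq_bigr => n _; rewrite -(hyper_coef_conv unit2 unit_lt) // mulr_suml.
  apply: eq_bigr => i _; have le_in : (i <= n)%N by rewrite -ltnS.
  by rewrite /F mulrACA -exprD subnKC.
rewrite /eqmod addrAC subrr add0r natrX.
apply: divides_sum => i _; rewrite big_nat.
apply: divides_sum => j /andP[le_ij lt_jp].
rewrite /F mulrACA; apply: divides_mull; apply: hyper_coef_tail => //.
by rewrite -leq_subLR.
Qed.
End SuperCongruence.

(** * The p-adic integers *)

Lemma padic_nat_unit (p k : nat) : prime p -> (0 < k < p)%N ->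
  (k%:R : padic_int p) \is a GRing.unit.
Proof.
move=> p_prime /andP[k_gt0 lt_kp].
rewrite -[_ \is a _]/(padic_unit _); apply/boolp.asboolP => n.
have gt1 : (1 < p ^ n.+1)%N by rewrite -(exp1n n.+1) ltn_exp2r ?prime_gt1.
rewrite padic_natE unitZpE // coprimeXl // prime_coprime //.
by rewrite gtnNdvd.
Qed.

Theorem theorem1p1 (p : nat) (p_prime : prime p) (p_odd : odd p)
    (alpha z : padic_int p)
    (alpha_even : (padic_residue (- alpha) = 0 %[mod 2])%N) :
  eqmod ((p ^ 2)%:R : padic_int p)
    (trunc_hypergeom [tuple 1 / 2 * alpha; 3 / 2 - 1 / 2 * alpha]
                     [tuple 1] z p.-1
     * trunc_hypergeom [tuple 1 / 2 * alpha; 1 / 2 - 1 / 2 * alpha]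
                       [tuple 1] z p.-1)
    (trunc_hypergeom [tuple alpha; 2 - alpha; 1 / 2] [tuple 1; 1] z p.-1).
Proof.
have p_gt1 := prime_gt1 p_prime.
have lt_ap := padic_residue_ltn p_gt1 (- alpha).
have unit_lt k : (0 < k < p)%N -> (k%:R : padic_int p) \is a GRing.unit.
  exact: padic_nat_unit.
have a_even : (padic_residue (- alpha))./2.*2 = padic_residue (- alpha).
  by apply: even_halfK; move: alpha_even; rewrite !modn2; case: odd.
apply: (@orr_supercongruence _ _ _ _ _ _ (padic_residue (- alpha))./2
          (p.-1 - padic_residue (- alpha))./2) => //.
- by apply: unit_lt; lia.
- by lia.
rewrite a_even; have [c Ec] := padic_residueP p_gt1 (- alpha).
by exists (- c); rewrite mulrN -Ec opprB opprK addrC.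
Qed.
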